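(* Let $\gamma \geq 0$ be an integer. The vector space of $\gamma$-edge valued binary trees (with at least one internal node), endowed with the operations $\prec_a, \succ_a$, $a \in [\gamma]$, defined recursively in the context, is the free $\gamma$-polydendriform algebra over one generator.
   Context: The ground field has characteristic zero; $[\gamma] = \{1, \dots, \gamma\}$; $a \downarrow a' := \min(a, a')$. A $\gamma$-polydendriform algebra is an algebra over the operad $\mathsf{Dendr}_\gamma$; equivalently, a vector space with binary linear operations $\prec_a, \succ_a$, $a \in [\gamma]$, satisfying for all elements $x, y, z$ and all $a, a' \in [\gamma]$: $(x \succ_{a'} y) \prec_a z = x \succ_{a'} (y \prec_a z)$; $(x \prec_{a'} y) \prec_a z = x \prec_{a \downarrow a'} (y \prec_a z) + x \prec_{a \downarrow a'} (y \succ_{a'} z)$; $(x \prec_{a'} y) \succ_{a \downarrow a'} z + (x \succ_a y) \succ_{a \downarrow a'} z = x \succ_a (y \succ_{a'} z)$. Free over one generator is meant in the category of such algebras (morphisms: linear maps commuting with all operations). A $\gamma$-edge valued binary tree is a planar binary tree (each internal node has exactly two children) with at least one internal node, in which every edge connecting two internal nodes is labeled by an element of $[\gamma]$. By convention, all edges connecting internal nodes with leaves are labeled by $\infty$, with $a \downarrow \infty = a = \infty \downarrow a$ for $a \in [\gamma]$. Denote by $\perp$ the leaf, and by $B(x, y; \mathfrak{t}_1, \mathfrak{t}_2)$ the tree whose root has left subtree $\mathfrak{t}_1$ attached by an edge labeled $x$ and right subtree $\mathfrak{t}_2$ attached by an edge labeled $y$ (extended bilinearly in $\mathfrak{t}_1,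 \mathfrak{t}_2$). The operations are defined linearly and recursively, for any $\gamma$-edge valued binary tree $\mathfrak{s}$ and any $\gamma$-edge valued binary trees or leaves $\mathfrak{t}_1, \mathfrak{t}_2$, by $\mathfrak{s} \prec_a \perp := \mathfrak{s} =: \perp \succ_a \mathfrak{s}$ and $\perp \prec_a \mathfrak{s} := 0 =: \mathfrak{s} \succ_a \perp$ (also for index $a = \infty$, which occurs in the recursion only when one operand is a leaf); $B(x, y; \mathfrak{t}_1, \mathfrak{t}_2) \prec_a \mathfrak{s} := B(x, z; \mathfrak{t}_1, \mathfrak{t}_2 \prec_a \mathfrak{s}) + B(x, z; \mathfrak{t}_1, \mathfrak{t}_2 \succ_y \mathfrak{s})$ with $z := a \downarrow y$; $\mathfrak{s} \succ_a B(x, y; \mathfrak{t}_1, \mathfrak{t}_2) := B(z, y; \mathfrak{s} \succ_a \mathfrak{t}_1, \mathfrak{t}_2) + B(z, y; \mathfrak{s} \prec_x \mathfrak{t}_1, \mathfrak{t}_2)$ with $z := a \downarrow x$. ($\perp \prec_a \perp$ and $\perp \succ_a \perp$ are not defined and never needed.) *)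

(* Defs.v *)
From HB Require Import structures.
From mathcomp Require Import all_boot all_order all_algebra.
From mathcomp Require Import freeg.
Set Implicit Arguments.
Unset Strict Implicit.
Unset Printing Implicit Defensive.
Import Order.TTheory GRing.Theory.
Local Open Scope ring_scope.

(* Throughout, the ordered set [gamma] = {1 < ... < gamma} is encoded by
   'I_gamma (shifted by one), and a \downarrow a' by Order.min a a'. *)

Section Polydendriform.
Variables (K : fieldType) (gamma : nat).

Record is_polydendriform (A : lmodType K) (prec succ : 'I_gamma -> A -> A -> A)
    : Prop := IsPolydendriform {
  prec_bilinear : forall a, bilinear_for *:%R *:%R (prec a);
  succ_bilinear : forall a, bilinear_for *:%R *:%R (succ a);
  succ_prec : forall (a a' : 'I_gamma) x y z,
    prec a (succ a' x y) z = succ a' x (prec a y z);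
  prec_prec : forall (a a' : 'I_gamma) x y z,
    prec a (prec a' x y) z =
      prec (Order.min a a') x (prec a y z)
      + prec (Order.min a a') x (succ a' y z);
  succ_succ : forall (a a' : 'I_gamma) x y z,
    succ (Order.min a a') (prec a' x y) z
    + succ (Order.min a a') (succ a x y) z =
      succ a x (succ a' y z)
}.

Definition is_polydendriform_morphism (A B : lmodType K)
    (precA succA : 'I_gamma -> A -> A -> A)
    (precB succB : 'I_gamma -> B -> B -> B) (f : A -> B) : Prop :=
  [/\ linear f,
      forall a x y, f (precA a x y) = precB a (f x) (f y)
    & forall a x y, f (succA a x y) = succB a (f x) (f y)].

Definition is_free_polydendriform_on_one_generator (A : lmodType K)
    (prec succ : 'I_gamma -> A -> A -> A) : Prop :=
  is_polydendriform prec succ /\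
  exists e : A,
    forall (B : lmodType K) (precB succB : 'I_gamma -> B -> B -> B),
      is_polydendriform precB succB ->
    forall b : B,
    exists f : A -> B,
      [/\ is_polydendriform_morphism prec succ precB succB f,
          f e = b
        & forall g : A -> B,
            is_polydendriform_morphism prec succ precB succB g ->
            g e = b -> g =1 f].

End Polydendriform.

(* Node l r is the tree whose root has the children l and r, where None is a
   leaf (attached by an edge labeled by infinity) and Some (x, t) is the tree t,
   with at least one internal node, attached by an edge labeled by x. *)
Inductive evtree (gamma : nat) : Type :=
  Node of option ('I_gamma * evtree gamma) & option ('I_gamma * evtree gamma).

Section TreeChoice.
Variable gamma : nat.
Local Notation tree := (evtree gamma).
Local Notation child := (option ('I_gamma * tree)).

Definition on_child (P : tree -> Prop) (c : child) : Prop :=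
  if c is Some (_, t) then P t else True.

Lemma evtree_nested_ind (P : tree -> Prop) :
  (forall l r, on_child P l -> on_child P r -> P (Node l r)) -> forall t, P t.
Proof.
move=> IH; fix rec 1 => -[l r]; apply: IH.
  by case: l => [[x t]|] //=; apply: rec.
by case: r => [[y t]|] //=; apply: rec.
Qed.

Fixpoint evtree_encode (t : tree) : GenTree.tree 'I_gamma :=
  let encode_child (c : child) :=
    if c is Some (x, u) then GenTree.Node 1 [:: GenTree.Leaf x; evtree_encode u]
    else GenTree.Node 0 [::] in
  let: Node l r := t in GenTree.Node 2 [:: encode_child l; encode_child r].

Fixpoint evtree_decode (g : GenTree.tree 'I_gamma) : option tree :=
  let decode_child g' : option child :=
    match g' with
    | GenTree.Node 1 [:: GenTree.Leaf x; h] =>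
        omap (fun u => Some (x, u)) (evtree_decode h)
    | _ => Some None
    end in
  match g with
  | GenTree.Node 2 [:: gl; gr] =>
      obind (fun l => omap (Node l) (decode_child gr)) (decode_child gl)
  | _ => None
  end.

Lemma evtree_encodeK : pcancel evtree_encode evtree_decode.
Proof.
elim/evtree_nested_ind => -[[x t]|] [[y u]|] //=.
- by move=> -> ->.
- by move=> ->.
- by move=> _ ->.
Qed.

HB.instance Definition _ := Countable.copy tree (pcan_type evtree_encodeK).

End TreeChoice.

Section TreeOperations.
Variables (K : fieldType) (gamma : nat).
Local Notation tree := (evtree gamma).
Local Notation child := (option ('I_gamma * tree)).
Local Notation V := {freeg tree / K}.

(* Linear extensions of B in one of its two subtrees; the other subtree and its
   edge label are given by the child c. *)
Definition graftl (z : 'I_gamma) (v : V) (c : child) : V :=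
  fglift (fun t => << Node (Some (z, t)) c >> : V) v.

Definition graftr (c : child) (z : 'I_gamma) (v : V) : V :=
  fglift (fun t => << Node c (Some (z, t)) >> : V) v.

(* tree_ops t s is the pair (a |-> t \prec_a s, a |-> t \succ_a s).
   When a child is a leaf, the conventions of the recursion give, since the
   label of its edge is infinity,
     B(x, oo; t1, leaf) \prec_a s
       = B(x, a; t1, leaf \prec_a s) + B(x, a; t1, leaf \succ_oo s)
       = 0 + B(x, a; t1, s),
     s \succ_a B(oo, y; leaf, t2)
       = B(a, y; s \succ_a leaf, t2) + B(a, y; s \prec_oo leaf, t2)
       = 0 + B(a, y; s, t2). *)
Fixpoint tree_ops (t : tree) : tree -> ('I_gamma -> V) * ('I_gamma -> V) :=
  fix tree_ops_t (s : tree) : ('I_gamma -> V) * ('I_gamma -> V) :=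
    let: Node tl tr := t in
    let: Node sl sr := s in
    (fun a => match tr with
       | None => graftr tl a << s >>
       | Some (y, t2) =>
           graftr tl (Order.min a y) ((tree_ops t2 s).1 a)
           + graftr tl (Order.min a y) ((tree_ops t2 s).2 y)
       end,
     fun a => match sl with
       | None => graftl a << t >> sr
       | Some (x, s1) =>
           graftl (Order.min a x) ((tree_ops_t s1).2 a) sr
           + graftl (Order.min a x) ((tree_ops_t s1).1 x) sr
       end).

Definition tree_prec (a : 'I_gamma) (t s : tree) : V := (tree_ops t s).1 a.
Definition tree_succ (a : 'I_gamma) (t s : tree) : V := (tree_ops t s).2 a.

Lemma tree_prec_leaf a l s :
  tree_prec a (Node l None) s = graftr l a << s >>.
Proof. by case: s. Qed.

Lemma tree_prec_edge a l y t2 s :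
  tree_prec a (Node l (Some (y, t2))) s =
    graftr l (Order.min a y) (tree_prec a t2 s)
    + graftr l (Order.min a y) (tree_succ y t2 s).
Proof. by case: s. Qed.

Lemma tree_succ_leaf a s r :
  tree_succ a s (Node None r) = graftl a << s >> r.
Proof. by case: s. Qed.

Lemma tree_succ_edge a s x t1 r :
  tree_succ a s (Node (Some (x, t1)) r) =
    graftl (Order.min a x) (tree_succ a s t1) r
    + graftl (Order.min a x) (tree_prec x s t1) r.
Proof. by case: s. Qed.

Definition bilinear_ext (op : tree -> tree -> V) (u v : V) : V :=
  fglift (fun t => fglift (op t) v) u.

Definition evtree_prec (a : 'I_gamma) : V -> V -> V :=
  bilinear_ext (tree_prec a).
Definition evtree_succ (a : 'I_gamma) : V -> V -> V :=
  bilinear_ext (tree_succ a).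

End TreeOperations.

(* Main.v *)
(* Every tree is a monomial in the one-node tree e, namely
   B(x, y; t1, t2) = (t1 \succ_x e) \prec_y t2 (with the factors t1, t2 omitted
   when they are leaves), so a morphism is determined by the image of e, and the
   same formula evaluates trees in any polydendriform algebra. The recursive
   definitions of \prec_a and \succ_a are instances of the second and third
   axioms; conversely, each of these two axioms at a triple of trees reduces to
   all three axioms at the triple with its first, resp. last, tree replaced by
   the right, resp. left, subtree of that tree. *)
Require Import Defs.
From HB Require Import structures.
From mathcomp Require Import all_boot all_order all_algebra.
From mathcomp Require Import freeg.
Set Implicit Arguments.
Unset Strict Implicit.
Unset Printing Implicit Defensive.
Import Order.TTheory GRing.Theory.
Local Open Scope ring_scope.

(** * Consequences of the bare linearity predicate *)

Section LinearProp.
Variables (K : fieldType) (U V : lmodType K) (f : U -> V).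
Hypothesis lin_f : linear f.

Lemma linear_funD u v : f (u + v) = f u + f v.
Proof. by have := lin_f 1 u v; rewrite !scale1r. Qed.

Lemma linear_fun0 : f 0 = 0.
Proof. by apply: (addrI (f 0)); rewrite -linear_funD !addr0. Qed.

Lemma linear_funZ c u : f (c *: u) = c *: f u.
Proof. by have := lin_f c u 0; rewrite linear_fun0 !addr0. Qed.

End LinearProp.

(** * Linear extension from a basis *)

Section FreeModule.
Variables (K : fieldType) (T : choiceType) (M : lmodType K).

Lemma freegZU (c : K) (t : T) : << c *g t >> = c *: << t >> :> {freeg T / K}.
Proof.
by apply/eqP/freeg_eqP => s; rewrite coeffZ !coeffU mul1r.
Qed.

Lemma fglift_linear (f : T -> M) : linear (fglift f).
Proof.
have lift0 : fglift f 0 = 0 by rewrite -freeg_nil fglift_Freeg prelift_nil.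
have liftD u v : fglift f (u + v) = fglift f u + fglift f v.
  (* This fact is about differences, so sums are reached through opposites. *)
  have liftB := @lift_is_additive K T M f.
  have liftN w : fglift f (- w) = - fglift f w.
    by rewrite -sub0r liftB lift0 sub0r.
  by rewrite -[v in LHS]opprK liftB liftN opprK.
move=> c u v; rewrite liftD; congr (_ + _).
have liftS (I : Type) (r : seq I) (F : I -> {freeg T / K}) :
    fglift f (\sum_(i <- r) F i) = \sum_(i <- r) fglift f (F i).
  exact: (big_morph _ liftD lift0).
rewrite -[u]freeg_sumE scaler_sumr !liftS scaler_sumr.
by apply: eq_bigr => t _; rewrite [in LHS]freegZU scalerA -freegZU
  !liftU scalerA.
Qed.

Lemma fgliftU1 (f : T -> M) (t : T) : fglift f << t >> = f t.
Proof. by rewrite liftU scale1r. Qed.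

(** Used to reduce multilinear identities to basis elements, one argument at a time. *)
Lemma linear_freeg_ext (f g : {freeg T / K} -> M) :
  linear f -> linear g -> (forall t, f << t >> = g << t >>) ->
  forall u, f u = g u.
Proof.
move=> lin_f lin_g fgU u; rewrite -[u]freeg_sumE.
rewrite (big_morph f (linear_funD lin_f) (linear_fun0 lin_f)).
rewrite (big_morph g (linear_funD lin_g) (linear_fun0 lin_g)).
by apply: eq_bigr => t _; rewrite freegZU !linear_funZ // fgU.
Qed.

End FreeModule.

(** * The operations as bilinear maps *)

Section TreeAlgebra.
Variables (K : fieldType) (gamma : nat).
Local Notation tree := (evtree gamma).
Local Notation child := (option ('I_gamma * tree)).
Local Notation V := {freeg tree / K}.
Local Notation prec := (@evtree_prec K gamma).
Local Notation succ := (@evtree_succ K gamma).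

Lemma bilinear_ext_linearl (op : tree -> tree -> V) v :
  linear (bilinear_ext op ^~ v).
Proof. exact: fglift_linear. Qed.

(** Both sides of the linearity equation are themselves linear in [u], so [u] may be taken to be a
    tree; only the inner lift then remains. *)
Lemma bilinear_ext_linearr (op : tree -> tree -> V) u :
  linear (bilinear_ext op u).
Proof.
move=> c v w; move: u; apply: linear_freeg_ext.
- exact: bilinear_ext_linearl.
- move=> d u u'; rewrite !(bilinear_ext_linearl op _ d u u').
  by rewrite !scalerDr !scalerA [c * d]mulrC addrACA.
- by move=> t; rewrite /bilinear_ext !fgliftU1 fglift_linear.
Qed.

Lemma bilinear_extUU op t s : bilinear_ext op << t >> << s >> = op t s :> V.
Proof. by rewrite /bilinear_ext !fgliftU1. Qed.

Lemma evtree_precUU a t s : prec a << t >> << s >> = tree_prec K a t s.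
Proof. exact: bilinear_extUU. Qed.

Lemma evtree_succUU a t s : succ a << t >> << s >> = tree_succ K a t s.
Proof. exact: bilinear_extUU. Qed.

Definition prec_linearl a v : linear (prec a ^~ v) := bilinear_ext_linearl _ v.
Definition prec_linearr a u : linear (prec a u) := bilinear_ext_linearr _ u.
Definition succ_linearl a v : linear (succ a ^~ v) := bilinear_ext_linearl _ v.
Definition succ_linearr a u : linear (succ a u) := bilinear_ext_linearr _ u.

Definition graftl_linear z c : linear ((@graftl K gamma z) ^~ c) :=
  fglift_linear _.
Definition graftr_linear c z : linear (@graftr K gamma c z) := fglift_linear _.

(** * The recursion with vectors as operands *)

(** The edge label and subtree that replace [l] when $u \succ_a$ acts on a tree with left child [l].
    Leaf and edge cases are merged here so that one formula covers both; the label does not depend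
    on [u]. *)
Definition act_left (a : 'I_gamma) (u : V) (l : child) : 'I_gamma * V :=
  if l is Some (x, t) then (Order.min a x, succ a u << t >> + prec x u << t >>)
  else (a, u).

Definition act_right (a : 'I_gamma) (r : child) (v : V) : 'I_gamma * V :=
  if r is Some (y, t) then (Order.min a y, prec a << t >> v + succ y << t >> v)
  else (a, v).

Lemma prec_Node a l r v :
  prec a << Node l r >> v = graftr l (act_right a r v).1 (act_right a r v).2.
Proof.
case: r => [[y t]|] /=; move: v; apply: linear_freeg_ext;
  try exact: prec_linearr.
- move=> c u v; rewrite prec_linearr succ_linearr -graftr_linear; congr graftr.
  by rewrite scalerDr addrACA.
- move=> s; rewrite !(evtree_precUU, evtree_succUU) tree_prec_edge.
  by rewrite (linear_funD (graftr_linear _ _)).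
- exact: graftr_linear.
- by move=> s; rewrite evtree_precUU tree_prec_leaf.
Qed.

Lemma succ_Node a u l r :
  succ a u << Node l r >> = graftl (act_left a u l).1 (act_left a u l).2 r.
Proof.
case: l => [[x t]|] /=; move: u; apply: linear_freeg_ext;
  try exact: (succ_linearl a << _ >>).
- move=> c u v; rewrite (prec_linearl _ << t >>) (succ_linearl _ << t >>).
  rewrite -(graftl_linear _ r); congr (graftl _ _ r).
  by rewrite scalerDr addrACA.
- move=> s; rewrite !(evtree_precUU, evtree_succUU) tree_succ_edge.
  by rewrite (linear_funD (graftl_linear _ r)).
- exact: (graftl_linear a r).
- by move=> s; rewrite evtree_succUU tree_succ_leaf.
Qed.

(** After grafting, the right child is never a leaf, so only the edge case of the recursion occurs,
    and it extends linearly in [u]. *)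
Lemma prec_graftr a l b u v :
  prec a (graftr l b u) v = graftr l (Order.min a b) (prec a u v + succ b u v).
Proof.
move: u; apply: linear_freeg_ext.
- by move=> c u u'; rewrite graftr_linear (prec_linearl a v).
- move=> c u u'; rewrite (prec_linearl a v) (succ_linearl b v) -graftr_linear.
  by rewrite scalerDr addrACA.
- by move=> t; rewrite /graftr fgliftU1 prec_Node.
Qed.

Lemma succ_graftl a u b v r :
  succ a u (graftl b v r) = graftl (Order.min a b) (succ a u v + prec b u v) r.
Proof.
move: v; apply: linear_freeg_ext.
- by move=> c v v'; rewrite (graftl_linear b r) succ_linearr.
- move=> c v v'; rewrite prec_linearr succ_linearr -(graftl_linear _ r).
  by rewrite scalerDr addrACA.
- by move=> t; rewrite /graftl fgliftU1 succ_Node.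
Qed.

(** * The three polydendriform axioms *)

(** On a tree [y], the left action changes only the left child of the root and the right action only
    the right child, so they commute without any induction. *)
Lemma evtree_succ_prec (a a' : 'I_gamma) x y z :
  prec a (succ a' x y) z = succ a' x (prec a y z).
Proof.
move: y; apply: linear_freeg_ext => [c y y'|c y y'|[l r]].
- by rewrite succ_linearr (prec_linearl a z).
- by rewrite (prec_linearl a z) succ_linearr.
rewrite succ_Node prec_Node.
set b := (act_left a' x l).1; set w := (act_left a' x l).2.
set c := (act_right a r z).1; set w' := (act_right a r z).2.
(* The common value is $B(b, c; w, w')$, extended bilinearly in both subtrees. *)
transitivity (fglift (fun t => graftr (Some (b, t)) c w') w).
  move: (w); apply: linear_freeg_ext; last 1 first.
  - by move=> t; rewrite /graftl !fgliftU1 prec_Node.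
  - by move=> d u u'; rewrite (graftl_linear b r) (prec_linearl a z).
  exact: fglift_linear.
move: (w'); apply: linear_freeg_ext.
- move=> d u u'; move: (w); apply: linear_freeg_ext => [|e v v'|t].
  + exact: fglift_linear.
  + rewrite !(fglift_linear _ e) !scalerDr !scalerA [d * e]mulrC.
    by rewrite addrACA.
  by rewrite !fgliftU1 graftr_linear.
- by move=> d u u'; rewrite graftr_linear succ_linearr.
move=> s; rewrite {2}/graftr fgliftU1 succ_Node -/b -/w.
move: (w); apply: linear_freeg_ext => [||t]; try exact: fglift_linear.
by rewrite /graftl /graftr !fgliftU1.
Qed.

Let prec_precU x z := forall (a a' : 'I_gamma) y,
  prec a (prec a' << x >> y) << z >> =
    prec (Order.min a a') << x >> (prec a y << z >> + succ a' y << z >>).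
Let succ_succU x z := forall (a a' : 'I_gamma) y,
  succ (Order.min a a') (prec a' << x >> y + succ a << x >> y) << z >> =
    succ a << x >> (succ a' y << z >>).

(** Each axiom calls the other, so they are proved together, by an outer induction on [x] for all
    [z] and an inner one on [z]. The middle argument is never decomposed and stays an arbitrary
    vector. *)
Lemma evtree_axiomsU x z : prec_precU x z /\ succ_succU x z.
Proof.
elim/evtree_nested_ind: x z => xl xr _ IHx.
elim/evtree_nested_ind => zl zr IHz _; split=> a a' y.
- rewrite [prec a' _ y]prec_Node [RHS]prec_Node prec_graftr.
  case: xr {IHz} IHx => [[b t]|] /= IHx; rewrite ?minA; congr (graftr _ _ _).
  have [IHp IHs] := IHx (Node zl zr).
  (* With [t] the right subtree of [x], the second and first axioms expand the $\prec_a$ part; the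
     third, at indices [b] and [a'], then handles the rest. *)
  rewrite (linear_funD (prec_linearl a _)) IHp evtree_succ_prec -addrA.
  rewrite [in X in _ + (_ + X)]minC IHs.
  by rewrite [in RHS](linear_funD (succ_linearr b _)).
- rewrite [succ a' y _]succ_Node [LHS]succ_Node succ_graftl.
  case: zl IHz => [[b t]|] /= IHz; last by rewrite addrC.
  rewrite -minA; congr (graftl _ _ _).
  case: IHz => IHp IHs.
  rewrite IHs [in X in _ = X + _](linear_funD (succ_linearr a _)).
  rewrite -addrA; congr (_ + _).
  (* The remaining $\prec_b$ part splits by the second and first axioms at the left subtree [t] of
     [z]. *)
  rewrite (linear_funD (prec_linearl b _)) IHp evtree_succ_prec.
  by rewrite minC [prec b y _ + _]addrC [LHS]addrC.
Qed.

Lemma evtree_prec_prec (a a' : 'I_gamma) x y z :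
  prec a (prec a' x y) z =
    prec (Order.min a a') x (prec a y z)
    + prec (Order.min a a') x (succ a' y z).
Proof.
rewrite -(linear_funD (prec_linearr _ x)).
move: x; apply: linear_freeg_ext => [c u v|c u v|t].
- by rewrite (prec_linearl a' y) (prec_linearl a z).
- exact: (prec_linearl _ (_ + _)).
move: z; apply: linear_freeg_ext => [c u v|c u v|s].
- exact: prec_linearr.
- rewrite (prec_linearr a y) (succ_linearr a' y) -(prec_linearr _ << t >>).
  by rewrite scalerDr addrACA.
by have [-> _] := evtree_axiomsU t s.
Qed.

Lemma evtree_succ_succ (a a' : 'I_gamma) x y z :
  succ (Order.min a a') (prec a' x y) z + succ (Order.min a a') (succ a x y) z =
    succ a x (succ a' y z).
Proof.
rewrite -(linear_funD (succ_linearl _ z)).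
move: x; apply: linear_freeg_ext => [c u v|c u v|t].
- rewrite (prec_linearl a' y) (succ_linearl a y) -(succ_linearl _ z) scalerDr.
  by rewrite addrACA.
- exact: (succ_linearl a (succ a' y z)).
move: z; apply: linear_freeg_ext => [c u v|c u v|s].
- exact: succ_linearr.
- by rewrite (succ_linearr a' y) succ_linearr.
by have [_ ->] := evtree_axiomsU t s.
Qed.

Lemma evtree_polydendriform : is_polydendriform prec succ.
Proof.
split=> *.
- by split=> u; [exact: prec_linearl | exact: prec_linearr].
- by split=> u; [exact: succ_linearl | exact: succ_linearr].
- exact: evtree_succ_prec.
- exact: evtree_prec_prec.
- exact: evtree_succ_succ.
Qed.

(** * Evaluation of trees in a polydendriform algebra *)

Section Evaluation.
Variables (B : lmodType K) (precB succB : 'I_gamma -> B -> B -> B) (b : B).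

Fixpoint eval_tree (t : tree) : B :=
  let: Node l r := t in
  let m := if l is Some (x, t1) then succB x (eval_tree t1) b else b in
  if r is Some (y, t2) then precB y m (eval_tree t2) else m.

Definition eval_left (l : child) : B :=
  if l is Some (x, t1) then succB x (eval_tree t1) b else b.

Definition eval_right (m : B) (r : child) : B :=
  if r is Some (y, t2) then precB y m (eval_tree t2) else m.

Lemma eval_tree_Node l r : eval_tree (Node l r) = eval_right (eval_left l) r.
Proof. by []. Qed.

Definition eval : V -> B := fglift eval_tree.

Hypothesis polyB : is_polydendriform precB succB.

Let precBl a v : linear (precB a ^~ v).
Proof. by have [lin_l _] := prec_bilinear polyB a. Qed.
Let precBr a u : linear (precB a u).
Proof. by have [_] := prec_bilinear polyB a; apply. Qed.
Let succBl a v : linear (succB a ^~ v).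
Proof. by have [lin_l _] := succ_bilinear polyB a. Qed.
Let succBr a u : linear (succB a u).
Proof. by have [_] := succ_bilinear polyB a; apply. Qed.
Let eval_linear : linear eval := fglift_linear _.

Lemma eval_right_linear r : linear (eval_right ^~ r).
Proof. by case: r => [[y t]|] // c u v; exact: (precBl y (eval_tree t)). Qed.

(** The first axiom lets a left factor pass through the right child. *)
Lemma eval_right_succ a u m r :
  eval_right (succB a u m) r = succB a u (eval_right m r).
Proof. by case: r => [[y t]|] //=; rewrite (succ_prec polyB). Qed.

Lemma eval_graftr l a v : eval (graftr l a v) = precB a (eval_left l) (eval v).
Proof.
move: v; apply: linear_freeg_ext => [c u v|c u v|t].
- by rewrite graftr_linear eval_linear.
- by rewrite eval_linear precBr.
by rewrite /eval /graftr !fgliftU1.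
Qed.

Lemma eval_graftl a v r :
  eval (graftl a v r) = eval_right (succB a (eval v) b) r.
Proof.
move: v; apply: linear_freeg_ext => [c u v|c u v|t].
- by rewrite (graftl_linear a r) eval_linear.
- by rewrite eval_linear (succBl a b) (eval_right_linear r).
by rewrite /eval /graftl !fgliftU1.
Qed.

(** The recursion for either operation calls both, and with a new index, hence the conjunction under
    a quantified [a]. The second and third axioms in [B] match the two recursive clauses. *)
Lemma eval_tree_ops t s : forall a,
  eval (tree_prec K a t s) = precB a (eval_tree t) (eval_tree s) /\
  eval (tree_succ K a t s) = succB a (eval_tree t) (eval_tree s).
Proof.
elim/evtree_nested_ind: t s => tl tr _ IHt.
elim/evtree_nested_ind => sl sr IHs _ a; split.
- case: tr {IHs} IHt => [[y t]|] /= IHt; last first.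
    by rewrite tree_prec_leaf eval_graftr /eval fgliftU1.
  have [IHp _] := IHt (Node sl sr) a; have [_ IHss] := IHt (Node sl sr) y.
  rewrite tree_prec_edge (linear_funD eval_linear) !eval_graftr IHp IHss.
  by rewrite (prec_prec polyB).
- rewrite [eval_tree (Node sl sr)]eval_tree_Node -eval_right_succ.
  case: sl IHs => [[x s]|] IHs; last first.
    by rewrite tree_succ_leaf eval_graftl /eval fgliftU1.
  have [_ IHss] := IHs a; have [IHp _] := IHs x.
  rewrite tree_succ_edge (linear_funD eval_linear) !eval_graftl IHp IHss.
  (* Gathered under the right child, the two terms form the left side of the third axiom with last
     argument [b]. *)
  rewrite -(linear_funD (eval_right_linear sr)) addrC.
  by rewrite (succ_succ polyB).
Qed.

Lemma eval_morphism : is_polydendriform_morphism prec succ precB succB eval.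
Proof.
split=> // a x y.
- move: x; apply: linear_freeg_ext => [c u v|c u v|t].
  + by rewrite (prec_linearl a y) eval_linear.
  + by rewrite eval_linear (precBl a (eval y)).
  move: y; apply: linear_freeg_ext => [c u v|c u v|s].
  + by rewrite prec_linearr eval_linear.
  + by rewrite eval_linear precBr.
  by rewrite evtree_precUU (eval_tree_ops t s a).1 /eval !fgliftU1.
- move: x; apply: linear_freeg_ext => [c u v|c u v|t].
  + by rewrite (succ_linearl a y) eval_linear.
  + by rewrite eval_linear (succBl a (eval y)).
  move: y; apply: linear_freeg_ext => [c u v|c u v|s].
  + by rewrite succ_linearr eval_linear.
  + by rewrite eval_linear succBr.
  by rewrite evtree_succUU (eval_tree_ops t s a).2 /eval !fgliftU1.
Qed.

Lemma eval_unique (g : V -> B) :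
  is_polydendriform_morphism prec succ precB succB g ->
  g << Node None None >> = b -> g =1 eval.
Proof.
move=> [lin_g g_prec g_succ] g_e; apply: linear_freeg_ext => // t.
rewrite /eval fgliftU1; elim/evtree_nested_ind: t => l r IHl IHr.
(* The tree is built from the generator in two steps: first the left subtree acts on it, then the
   right one. *)
have g_left : g << Node l None >> = eval_left l.
  case: l IHl => [[x t]|] //= <-; rewrite -g_e -g_succ succ_Node /=.
  by rewrite /graftl fgliftU1.
case: r IHr => [[y t]|] //= IHr.
rewrite -IHr -/(eval_left l) -g_left -g_prec prec_Node /=.
by rewrite /graftr fgliftU1.
Qed.

End Evaluation.
End TreeAlgebra.

(** * Freeness on the one-node tree *)

Theorem theorem4p2p3 (K : fieldType) (charK0 : [pchar K] =i pred0) (gamma : nat) :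
  @is_free_polydendriform_on_one_generator K gamma {freeg (evtree gamma) / K}
    (@evtree_prec K gamma) (@evtree_succ K gamma).
Proof.
split; first exact: evtree_polydendriform.
exists << Node None None >> => B precB succB polyB b.
exists (eval precB succB b); split.
- exact: eval_morphism.
- by rewrite /eval fgliftU1.
- by move=> g; exact: eval_unique.
Qed.
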